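(* Let $\alpha,\beta\in\mathbb C\setminus\mathbb R$ with $\alpha\ne\beta,\bar\beta$, and let $W,V\subset\mathbb C^{2n}$ be Lagrangian subspaces. Then $$p_{\beta,\,p_{\alpha,W}(\beta)V}\;p_{\alpha,W}=p_{\alpha,\,p_{\beta,V}(\alpha)W}\;p_{\beta,V}.$$
   Context: Let $\omega(v,w)={}^tvJw$ on $\mathbb C^{2n}$, with $J=\begin{pmatrix}0&I_n\\-I_n&0\end{pmatrix}$. A Lagrangian subspace is an $n$-dimensional complex subspace on which $\omega$ vanishes. For $\alpha\in\mathbb C\setminus\mathbb R$ and $W$ Lagrangian, $p_{\alpha,W}(\lambda)=\frac{\lambda-\alpha}{\lambda-\bar\alpha}\pi_W+\pi_{W^\perp}$, where $\perp$ is the orthogonal complement for the standard hermitian inner product and $\pi_W,\pi_{W^\perp}$ are the orthogonal projections. For $\lambda\neq\alpha,\bar\alpha$ the matrix $p_{\alpha,W}(\lambda)$ preserves $\omega$ up to a nonzero scalar, so it maps Lagrangian subspaces to Lagrangian subspaces. *)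

(* Defs.v *)
From HB Require Import structures.
From mathcomp Require Import all_boot all_order all_algebra.
From mathcomp Require Export complex.
From mathcomp Require Export reals.

Set Implicit Arguments.
Unset Strict Implicit.
Unset Printing Implicit Defensive.

Import Order.TTheory GRing.Theory Num.Theory.
Local Open Scope ring_scope.
Local Open Scope sesquilinear_scope.

Section Hermitian.
Variables (C : numClosedFieldType) (m : nat).
Implicit Types (u v w : 'cV[C]_m) (W V : {vspace 'cV[C]_m}).

Let hermitian1 : (1%:M : 'M[C]_1) \is hermsymmx.
Proof. by rewrite is_hermitianmxE expr0 scale1r tr_scalar_mx map_mx1. Qed.

(* The inner form on column vectors is \tr (u *m 1%:M *m v ^t conj), with a
   1 x 1 identity matrix in the middle; see hdotE. *)
Definition hdot u v : C :=
  form_of_matrix (Num.conj : C -> C) (mx_of_hermitian (HermitianMx hermitian1)) u v.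

HB.instance Definition _ := Bilinear.copy hdot
  (form_of_matrix (Num.conj : C -> C) (mx_of_hermitian (HermitianMx hermitian1))).
HB.instance Definition _ := Hermitian.copy hdot
  (form_of_matrix (Num.conj : C -> C) (mx_of_hermitian (HermitianMx hermitian1))).

Lemma hdotE u v : hdot u v = \sum_i u i 0 * (v i 0)^*.
Proof.
rewrite /hdot /form_of_matrix /= mulmx1 /mxtrace; apply: eq_bigr => i _.
by rewrite mxE big_ord1 !mxE.
Qed.

Definition orthocompl W : {vspace 'cV[C]_m} := orthov hdot W.

Lemma orthocomplP W u :
  reflect {in W, forall w, hdot u w = 0} (u \in orthocompl W).
Proof. exact: mem_orthovP. Qed.

Lemma orthocompl_cap W : (W :&: orthocompl W)%VS = 0%VS.
Proof.
apply/eqP; rewrite -subv0; apply/subvP => u; rewrite memv_cap => /andP[uW].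
move=> /orthocomplP /(_ u uW) /eqP; rewrite hdotE psumr_eq0; last first.
  by move=> i _; rewrite mul_conjC_ge0.
move=> /allP u0; rewrite memv0; apply/eqP/colP => i; rewrite mxE; apply/eqP.
by rewrite -mul_conjC_eq0; exact: (u0 i (mem_index_enum i)).
Qed.

Lemma orthocompl_add W : (W + orthocompl W)%VS = fullv.
Proof.
apply/eqP; rewrite -(geq_leqif (dimv_leqif_eq (subvf _))).
rewrite (dimv_disjoint_sum (orthocompl_cap W)).
pose A : 'M[C]_(\dim W, m) := \matrix_(i, j) (((vbasis W)`_i) j 0)^*.
have kerA : (lker (linfun (mulmx A : 'cV_m -> 'cV_(\dim W))) <= orthocompl W)%VS.
  apply/subvP => u; rewrite memv_ker lfunE /= => /eqP /colP Au0.
  apply/orthocomplP => w /coord_vbasis ->; rewrite linear_sumr big1 // => i _.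
  rewrite linearZr_LR /= hdotE; have := Au0 i; rewrite !mxE => Aui.
  suff -> : \sum_k u k 0 * ((vbasis W)`_i k 0)^* = 0 by rewrite mulr0.
  by rewrite -[RHS]Aui; apply: eq_bigr => k _; rewrite mxE mulrC.
have := limg_ker_dim (linfun (mulmx A : 'cV_m -> 'cV_(\dim W))) fullv.
rewrite capfv => <-; rewrite addnC leq_add ?dimvS //.
by rewrite (leq_trans (dimvS (subvf _))) // dimvf /dim /= muln1.
Qed.

(* The matrix, acting on columns, of the projection onto W along orthocompl W. *)
Definition orthoproj W : 'M[C]_m :=
  \matrix_(i, j) (daddv_pi W (orthocompl W) (delta_mx j 0)) i 0.

Lemma mul_orthoproj W v : orthoproj W *m v = daddv_pi W (orthocompl W) v.
Proof.
have {2}-> : v = \sum_j v j 0 *: delta_mx j 0.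
  rewrite [LHS]matrix_sum_delta; apply: eq_bigr => j _.
  by rewrite big_ord1.
rewrite linear_sum; apply/colP => i; rewrite mxE summxE.
by apply: eq_bigr => j _; rewrite linearZ !mxE mulrC.
Qed.

Definition mximg (A : 'M[C]_m) V : {vspace 'cV[C]_m} := (linfun (mulmx A) @: V)%VS.

Definition simple_factor (alpha : C) W (lambda : C) : 'M[C]_m :=
  ((lambda - alpha) / (lambda - alpha^*)) *: orthoproj W
  + orthoproj (orthocompl W).

End Hermitian.

Section Symplectic.
Variables (C : numClosedFieldType) (n : nat).

Definition Jmx : 'M[C]_(n + n) := block_mx 0 1%:M (- 1%:M) 0.

Definition omega (v w : 'cV[C]_(n + n)) : C := (v^T *m Jmx *m w) 0 0.

Definition lagrangian (W : {vspace 'cV[C]_(n + n)}) : Prop :=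
  \dim W = n /\ {in W &, forall v w, omega v w = 0}.

End Symplectic.

(* Main.v *)
Require Import Defs.
From mathcomp Require Import all_boot all_order all_algebra.
Import Order.TTheory GRing.Theory Num.Theory.
Local Open Scope ring_scope.

Set Implicit Arguments.
Unset Strict Implicit.
Unset Printing Implicit Defensive.

(** Write [S] for the matrix acting as [alpha] on [W] and as its conjugate
[alpha'] on the orthogonal complement of [W].  Then [lambda - alpha'] times
[p_{alpha,W}(lambda)] is just [lambda - S].  With [T], [S'], [T'] defined likewise
from [(beta, V)], [(alpha, W')], [(beta, V')], where [W'] and [V'] are the
transformed subspaces, the theorem becomes the identity of quadratic polynomials
[(lambda - T') (lambda - S) = (lambda - S') (lambda - T)].

The key is the matrix [N = T - S].  On [V] it is [beta - S], and on the
orthogonal complement of [V] it is [beta' - S], where [beta'] is the conjugate of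
[beta].  The first maps [V] onto [V'], and the second maps the complement of [V]
into that of [V'], because the adjoint of [beta - S] times [beta' - S] is scalar
([hdot_sub_spectralmx]).  Hence [T' N = N T], and by symmetry [S' N = N S]
([spectralmx_intertwine]).  The same scalar identity shows that [N] is injective
([spectralmx_sub_unit]): if [S x = T x], computing the scalar from [S] and from
[T] at its root [alpha] gives [(alpha - beta) (alpha - beta') |x|^2 = 0].
Cancelling [N] then yields [T' + S = S' + T] and [T' S = S' T]
([dressing_exchange]), which are the coefficients of the two quadratics. *)

Section OrthogonalProjection.
Variables (C : numClosedFieldType) (m : nat).
Implicit Types (u v w x y : 'cV[C]_m) (W V : {vspace 'cV[C]_m}).

Lemma hdotC u v : hdot u v = (hdot v u)^*.
Proof.
rewrite !hdotE rmorph_sum; apply: eq_bigr => i _.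
by rewrite rmorphM /= conjCK mulrC.
Qed.

Lemma hdot_eq0 x : (hdot x x == 0) = (x == 0).
Proof.
apply/idP/eqP => [|->]; last by rewrite linear0l.
rewrite hdotE psumr_eq0 => [/allP x0|i _]; last by rewrite mul_conjC_ge0.
apply/colP => i; rewrite mxE; apply/eqP; rewrite -mul_conjC_eq0.
exact: (x0 i (mem_index_enum i)).
Qed.

Lemma orthocompl_hdot W w u : w \in W -> u \in orthocompl W ->
  (hdot w u = 0) * (hdot u w = 0).
Proof.
by move=> wW /orthocomplP /(_ w wW) uw0; rewrite [hdot w u]hdotC uw0 conjC0.
Qed.

Lemma orthocompl_split W v :
  exists w u, [/\ v = w + u, w \in W & u \in orthocompl W].
Proof.
have : v \in (W + orthocompl W)%VS by rewrite orthocompl_add memvf.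
by case/memv_addP => w wW [u uW ->]; exists w, u.
Qed.

Lemma orthoprojD W w u : w \in W -> u \in orthocompl W ->
  orthoproj W *m (w + u) = w.
Proof.
move=> wW uW; rewrite mul_orthoproj linearD /=.
rewrite (daddv_pi_id (orthocompl_cap W) wW).
have capC : (orthocompl W :&: W)%VS = 0%VS by rewrite capvC orthocompl_cap.
have := daddv_pi_add (orthocompl_cap W) (subvP (addvSr W _) _ uW).
rewrite (daddv_pi_id capC uW) => piu.
by rewrite (addIr u (etrans piu (esym (add0r u)))) addr0.
Qed.

(** Since [W] and its complement span the space, it suffices that [W] is
contained in its double complement. *)
Lemma orthoproj_complD W w u : w \in W -> u \in orthocompl W ->
  orthoproj (orthocompl W) *m (w + u) = u.
Proof.
move=> wW uW; rewrite addrC orthoprojD //; apply/orthocomplP => v vW.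
by rewrite (orthocompl_hdot wW vW).
Qed.

Lemma mulmx_cV_inj n (A B : 'M[C]_(n, m)) :
  (forall v : 'cV_m, A *m v = B *m v) -> A = B.
Proof.
move=> eqAB; apply/matrixP => i j.
by have /colP/(_ i) := eqAB (delta_mx j 0); rewrite -!colE !mxE.
Qed.

End OrthogonalProjection.

Section Spectral.
Variables (C : numClosedFieldType) (m : nat).
Implicit Types (u v w x y : 'cV[C]_m) (W V : {vspace 'cV[C]_m}).

Definition spectralmx (alpha : C) W : 'M[C]_m :=
  alpha *: orthoproj W + alpha^* *: orthoproj (orthocompl W).

Lemma spectralmxD alpha W w u : w \in W -> u \in orthocompl W ->
  spectralmx alpha W *m (w + u) = alpha *: w + alpha^* *: u.
Proof.
by move=> wW uW; rewrite mulmxDl -!scalemxAl orthoprojD ?orthoproj_complD.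
Qed.

Lemma spectralmx_id alpha W w : w \in W ->
  spectralmx alpha W *m w = alpha *: w.
Proof.
by move=> wW; rewrite -{1}[w]addr0 spectralmxD ?mem0v // scaler0 addr0.
Qed.

Lemma spectralmx_compl alpha W u : u \in orthocompl W ->
  spectralmx alpha W *m u = alpha^* *: u.
Proof.
by move=> uW; rewrite -{1}[u]add0r spectralmxD ?mem0v // scaler0 add0r.
Qed.

(** Clearing the pole of a simple factor leaves a linear polynomial. *)
Lemma simple_factorE alpha W lambda : lambda != alpha^* ->
  simple_factor alpha W lambda
  = (lambda - alpha^*)^-1 *: (lambda%:M - spectralmx alpha W).
Proof.
rewrite -subr_eq0 => la0; apply: mulmx_cV_inj => v.
have [w [u [-> wW uW]]] := orthocompl_split W v.
rewrite mulmxDl -!scalemxAl orthoprojD ?orthoproj_complD // mulmxBl.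
rewrite spectralmxD // mul_scalar_mx [lambda *: _]scalerDr opprD addrACA -!scalerBl.
by rewrite scalerDr !scalerA mulVf // scale1r [_^-1 * _]mulrC.
Qed.

(** With [alpha'] the conjugate of [alpha], the adjoint of [S = spectralmx alpha W]
is [alpha + alpha' - S].  So with [z'] the conjugate of [z], the adjoint of
[z - S] times [z' - S] is the scalar [(z' - alpha) (z' - alpha')], by which the form
gets multiplied. *)
Lemma hdot_sub_spectralmx alpha W z x y :
  hdot ((z^*)%:M *m x - spectralmx alpha W *m x)
       (z%:M *m y - spectralmx alpha W *m y)
  = (z^* - alpha) * (z^* - alpha^*) * hdot x y.
Proof.
have [x1 [x2 [-> x1W x2W]]] := orthocompl_split W x.
have [y1 [y2 [-> y1W y2W]]] := orthocompl_split W y.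
rewrite !spectralmxD // !mul_scalar_mx !scalerDr !opprD !(addrACA _ _ (- _)).
rewrite -!scalerBl !linearDl /= !linearDr /= !linearZl_LR /= !linearZr_LR /=.
rewrite (orthocompl_hdot x1W y2W) (orthocompl_hdot y1W x2W).
rewrite !mulr0 !addr0 !add0r !rmorphB /= conjCK !mulrA.
by rewrite [(_ - alpha^*) * _]mulrC -mulrDr.
Qed.

Lemma spectralmx_sub_unit alpha beta W V :
  alpha != beta -> alpha != beta^* ->
  spectralmx beta V - spectralmx alpha W \in unitmx.
Proof.
move=> ab ab'; rewrite -unitmx_tr -row_free_unit.
apply: inj_row_free => r /(congr1 trmx).
rewrite trmx_mul trmxK trmx0 mulmxBl => /eqP; rewrite subr_eq0 => /eqP TS.
(* For z the conjugate of alpha the scalar of S vanishes; that of T does not. *)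
have := hdot_sub_spectralmx beta V alpha^* r^T r^T.
rewrite TS hdot_sub_spectralmx conjCK subrr !mul0r => /esym/eqP.
rewrite !mulf_eq0 !subr_eq0 (negPf ab) (negPf ab') /= hdot_eq0.
by move=> /eqP r0; rewrite -[r]trmxK r0 trmx0.
Qed.

(** The difference of the two spectral matrices carries [V] and its orthogonal
complement into the eigenspaces of the transformed spectral matrix. *)
Lemma spectralmx_intertwine alpha beta W V : beta != alpha^* ->
  let V' := mximg (simple_factor alpha W beta) V in
  let N := spectralmx beta V - spectralmx alpha W in
  spectralmx beta V' *m N = N *m spectralmx beta V.
Proof.
move=> ba V' N; have ba0 := ba; rewrite -subr_eq0 in ba0.
have imgV v : v \in V -> (beta%:M - spectralmx alpha W) *m v \in V'.
  move=> vV; apply/memv_imgP; exists ((beta - alpha^*) *: v); first exact: memvZ.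
  by rewrite lfunE /= simple_factorE // -scalemxAl -scalemxAr scalerA mulVf ?scale1r.
have imgVC u : u \in orthocompl V ->
    ((beta^*)%:M - spectralmx alpha W) *m u \in orthocompl V'.
  move=> uV; apply/orthocomplP => _ /memv_imgP[v vV ->].
  rewrite lfunE /= simple_factorE // -scalemxAl linearZr_LR /= !mulmxBl.
  by rewrite hdot_sub_spectralmx (orthocompl_hdot vV uV) !mulr0.
apply: mulmx_cV_inj => x; have [v [u [-> vV uV]]] := orthocompl_split V x.
have Nv : N *m v = (beta%:M - spectralmx alpha W) *m v.
  by rewrite !mulmxBl spectralmx_id // mul_scalar_mx.
have Nu : N *m u = ((beta^*)%:M - spectralmx alpha W) *m u.
  by rewrite !mulmxBl spectralmx_compl // mul_scalar_mx.
rewrite -!mulmxA spectralmxD // mulmxDr [in RHS]mulmxDr -!scalemxAr Nv Nu.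
by rewrite spectralmxD ?imgV ?imgVC.
Qed.

End Spectral.

(** Intertwining with [N = T - S] makes [T'] and [S'] differ from [T] and [S] by
the same matrix: [(T' - T) N] and [(S' - S) N] are the commutators of [N] with
[T] and with [S], which agree because [N] commutes with itself.  This settles
the linear coefficients; the constant ones then follow from the intertwining
relation of [T']. *)
Lemma dressing_exchange (F : fieldType) m (S T S' T' : 'M[F]_m) lambda :
  T - S \in unitmx ->
  T' *m (T - S) = (T - S) *m T -> S' *m (T - S) = (T - S) *m S ->
  (lambda%:M - T') *m (lambda%:M - S) = (lambda%:M - S') *m (lambda%:M - T).
Proof.
move=> Nunit T'N S'N.
have sumE : T' + S = S' + T.
  apply: (can_inj (mulmxK Nunit)); rewrite !mulmxDl T'N S'N.
  rewrite !mulmxBl !mulmxBr addrA subrK.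
  by rewrite [RHS]addrC addrA subrK.
have prodE : T' *m S = S' *m T.
  have T'E : T' = S' + T - S by rewrite -sumE addrK.
  move: T'N; rewrite mulmxBr mulmxBl => /eqP.
  rewrite subr_eq addrC -subr_eq => /eqP <-.
  by rewrite {1}T'E mulmxBl mulmxDl opprB addrA subrK addrK.
have expand (A B : 'M[F]_m) : (lambda%:M - A) *m (lambda%:M - B)
    = lambda *: lambda%:M - lambda *: (A + B) + A *m B.
  rewrite mulmxBl !mulmxBr !mul_scalar_mx mul_mx_scalar scalerDr opprB opprD.
  by rewrite -!addrA [in LHS](addrA _ (A *m B)) [in LHS](addrC _ (- _)).
by rewrite !expand sumE prodE.
Qed.

Lemma simple_factor_exchange (C : numClosedFieldType) m
    (W V : {vspace 'cV[C]_m}) (alpha beta lambda : C) :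
  alpha != beta -> alpha != beta^* ->
  lambda != alpha^* -> lambda != beta^* ->
  simple_factor beta (mximg (simple_factor alpha W beta) V) lambda
    *m simple_factor alpha W lambda
  = simple_factor alpha (mximg (simple_factor beta V alpha) W) lambda
    *m simple_factor beta V lambda.
Proof.
move=> alpha_neq_beta alpha_neq_conj_beta lambda_reg_alpha lambda_reg_beta.
have beta_neq_conj_alpha : beta != alpha^*.
  by rewrite -(inj_eq (inv_inj conjCK)) conjCK eq_sym.
have clear_poles (a b : C) (A B : 'M[C]_m) :
    (a *: A) *m (b *: B) = (a * b) *: (A *m B).
  by rewrite -scalemxAl -scalemxAr scalerA.
rewrite !(simple_factorE _ lambda_reg_alpha) !(simple_factorE _ lambda_reg_beta).
rewrite !clear_poles [X in X *: _]mulrC.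
congr (_ *: _); apply: dressing_exchange.
- exact: spectralmx_sub_unit.
- exact: spectralmx_intertwine.
(* Exchanging the roles of the two subspaces changes the sign of T - S. *)
- apply: oppr_inj; rewrite -mulmxN -mulNmx opprB; exact: spectralmx_intertwine.
Qed.

Theorem corollary4p3 (R : realType) (n : nat) (alpha beta : R[i])
    (W V : {vspace 'cV[R[i]]_(n + n)})
    (alphaNreal : alpha \isn't Num.real) (betaNreal : beta \isn't Num.real)
    (alpha_neq_beta : alpha != beta) (alpha_neq_conj_beta : alpha != beta^*)
    (lagW : lagrangian W) (lagV : lagrangian V)
    (lambda : R[i])
    (lambda_reg_alpha : lambda != alpha^*) (lambda_reg_beta : lambda != beta^*) :
  simple_factor beta (mximg (simple_factor alpha W beta) V) lambda
    *m simple_factor alpha W lambda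
  = simple_factor alpha (mximg (simple_factor beta V alpha) W) lambda
    *m simple_factor beta V lambda.
Proof. exact: simple_factor_exchange. Qed.
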